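(* A $k$-translatable left unitary groupoid is medial, but it is not right distributive.
   Context: A groupoid is a set with a binary operation $\cdot$. It is medial if $(x\cdot y)\cdot(z\cdot w)=(x\cdot z)\cdot(y\cdot w)$ for all $x,y,z,w$, and right distributive if $(x\cdot y)\cdot z=(x\cdot z)\cdot(y\cdot z)$ for all $x,y,z$. For an integer $x$, $[x]_n$ denotes the residue of $x$ modulo $n$, represented in $\{1,\ldots,n\}$, with $0$ identified with $n$. All groupoids are finite and taken to be of the form $Q=\{1,\ldots,n\}$ with the natural ordering. For $1\le k<n$, $Q$ is $k$-translatable if in its multiplication table each row $i$, $2\le i\le n$, is obtained from row $i-1$ by cyclically shifting it $k$ places to the right, i.e. $i\cdot j=(i-1)\cdot[j-k]_n$ for all $j$ and all $2\le i\le n$. It is left unitary if $1$ is a left neutral element, i.e. $1\cdot x=x$ for all $x$. *)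

(* Defs.v *)
From mathcomp Require Import all_boot all_order all_algebra.
Set Implicit Arguments.
Unset Strict Implicit.
Unset Printing Implicit Defensive.

Import Order.TTheory GRing.Theory Num.Theory.

Definition Q (n : nat) : Type := {x : nat | 1 <= x <= n}.

(* The residue is taken in {1, ..., n}: multiples of n are sent to n, not to 0 *)
Definition residue (n : nat) (x : int) : nat :=
  if (n %| x)%Z then n else `|(x %% n)%Z|%N.

Lemma residue_bounds (n : nat) (x : int) : 0 < n -> 1 <= residue n x <= n.
Proof.
move=> n_gt0; rewrite /residue; case: ifPn => [_|ndvd]; first by rewrite n_gt0 /=.
have n0 : (n%:Z != 0)%R by rewrite eqz_nat -lt0n.
have xm0 : ((x %% n)%Z != 0)%R.
  by apply: contraNneq ndvd => xm; apply/dvdz_mod0P.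
rewrite absz_gt0 xm0 /=.
by rewrite -lez_nat abszE ger0_norm ?modz_ge0 // ltW // ltz_pmod.
Qed.

(* Row i' is the row just above row i, and j' stands for [j - k]_n, which is an
   element of Q n by residue_bounds *)
Definition translatable (n k : nat) (op : Q n -> Q n -> Q n) : Prop :=
  forall i i' j j' : Q n,
    val i = (val i').+1 ->
    val j' = residue n ((val j)%:Z - k%:Z)%R ->
    op i j = op i' j'.

Definition left_unitary (n : nat) (op : Q n -> Q n -> Q n) : Prop :=
  exists2 e : Q n, val e = 1 & left_id e op.

Definition medial (T : Type) (op : T -> T -> T) : Prop := interchange op op.

(* (x . y) . z = (x . z) . (y . z): right self-distributivity is called
   left_distributive in ssrfun *)
Definition right_self_distributive (T : Type) (op : T -> T -> T) : Prop :=
  left_distributive op op.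

(* Main.v *)
Require Import Defs.
From mathcomp Require Import all_boot all_order all_algebra.
From mathcomp Require Import ring zify.

(** Since the first row of the table is 1, ..., n and every later row is the
    previous one shifted by k, the product is affine modulo n:
    i . j = j - (i - 1) k  ([translatable_mulE]).  As elements of {1, ..., n}
    are determined by their residues ([Q_eqmod_inj]), identities in the
    groupoid become polynomial congruences.

    Mediality holds because both sides of it are congruent to
    w - (y + z) k + (x - 1) k ^ 2 + 2 k, which is symmetric in y and z.
    Right distributivity already fails at (1 . 1) . 2: this is 2, whereas
    (1 . 2) . (1 . 2) = 2 . 2 is congruent to 2 - k, and n does not divide k
    because 0 < k < n. *)

Import GRing.Theory Num.Theory.

Lemma residue_eqmod (n : nat) (x : int) :
  0 < n -> (n %| ((residue n x)%:Z - x)%R)%Z.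
Proof.
move=> n_gt0; rewrite /residue; case: ifPn => [ndvd | _].
  by rewrite rpredB // dvdzz.
have n0 : (n%:Z != 0)%R by rewrite eqz_nat -lt0n.
by rewrite abszE ger0_norm ?modz_ge0 // -eqz_mod_dvd; apply/eqP; exact: modz_mod.
Qed.

Lemma Q_eqmod_inj (n : nat) (a b : Q n) :
  (n %| ((val a)%:Z - (val b)%:Z)%R)%Z -> a = b.
Proof.
move=> /dvdzP[q hq]; apply: val_inj.
have := valP a; have := valP b; move: hq => /=; move: (sval a) (sval b).
move=> u v hq /andP[v1 vn] /andP[u1 un].
suff q0 : q = 0%R by move: hq; rewrite q0; lia.
nia.
Qed.

(** Going down one row adds a shift by k, so this is an induction on the row
    number, starting from the neutral row 1. *)
Lemma translatable_mulE (n k : nat) (op : Q n -> Q n -> Q n) :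
  translatable k op -> left_unitary op ->
  forall i j : Q n,
    (n %| ((val (op i j))%:Z - ((val j)%:Z - ((val i)%:Z - 1) * k%:Z))%R)%Z.
Proof.
move=> trans [e e1 eop] i; have [m] := ubnP (val i).
elim: m i => // m IHm i im j.
have /andP[i1 iLn] := valP i; have n_gt0 : 0 < n by exact: leq_trans iLn.
case: (ltnP 1 (val i)) => [i_gt1 | i_le1]; last first.
  have -> : i = e by apply: val_inj; rewrite e1; apply/eqP; rewrite eqn_leq i_le1.
  by rewrite eop e1 subrr mul0r subr0 subrr dvdz0.
have i'P : 1 <= (val i).-1 <= n by move: i_gt1 iLn; clear; lia.
pose i' : Q n := Sub (val i).-1 i'P.
pose j' : Q n :=
  Sub (residue n ((val j)%:Z - k%:Z)%R) (residue_bounds _ n_gt0).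
have ii' : val i = (val i').+1 by rewrite /= prednK.
rewrite (trans i i' j j' ii' erefl) ii'.
have i'm : val i' < m by rewrite -ltnS -ii'.
have := rpredD (IHm i' i'm j') (residue_eqmod n ((val j)%:Z - k%:Z)%R n_gt0).
have -> : ((val i').+1%:Z = (val i')%:Z + 1)%R by rewrite -addn1 PoszD.
by congr (is_true (_ %| _)%Z); rewrite [val j']/=; ring.
Qed.

Theorem theorem3p2 (n k : nat) (op : Q n -> Q n -> Q n)
  (hk : 1 <= k < n) (htrans : translatable k op) (hunit : left_unitary op) :
  medial op /\ ~ right_self_distributive op.
Proof.
have opE := translatable_mulE n k op htrans hunit.
split=> [x y z w | rdist].
  apply: Q_eqmod_inj.
  have /dvdzP[a ea] := opE (op x y) (op z w).
  have /dvdzP[b eb] := opE (op x z) (op y w).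
  have /dvdzP[c ec] := opE x y.
  have /dvdzP[d ed] := opE z w.
  have /dvdzP[f ef] := opE x z.
  have /dvdzP[g eg] := opE y w.
  (* In i . j the left factor i has coefficient - k and the right one 1: these
     are the weights of the errors c, f and d, g of the inner products. *)
  apply/dvdzP; exists (a + d - c * Posz k - (b + g - f * Posz k))%R.
  rewrite !mulrBl !mulrDl !(mulrAC _ (Posz k)) -ea -eb -ec -ed -ef -eg.
  ring.
have [e e1 eop] := hunit.
have two_bounds : 1 <= 2 <= n by move: hk; clear; lia.
pose t : Q n := Sub 2 two_bounds.
have := opE t t; have := rdist e e t; rewrite !eop => <- /=.
have -> : (Posz 2 - (Posz 2 - (Posz 2 - 1) * Posz k) = Posz k)%R by ring.
case/andP: hk => k_gt0 k_lt_n.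
by rewrite dvdzE /= gtnNdvd.
Qed.
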